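(* Let $N$ be a tensor network with structure graph $G$ and let $w \in \mathbb{N}$. Then $N$ has a contraction tree of max rank $w$ if and only if $G$ has a carving decomposition of width $w$. Moreover, given one of these objects the other can be constructed in $O(|N|)$ time.
   Context: A graph $G$ has a nonempty vertex set $\mathcal{V}(G)$, an edge set $\mathcal{E}(G)$, incidence maps $\delta_G$ (vertex to set of incident edges) and $\epsilon_G$ (edge to its two endpoints); multiple edges are allowed. A tree is a simple connected acyclic graph; a leaf is a vertex of degree one, and $\mathcal{L}(T)$ denotes the set of leaves of $T$. An unrooted binary tree is a tree all of whose vertices have degree 1 or 3. A rooted binary tree is a tree $T$ that either is a single vertex (the root), or in which every vertex has degree 1 or 3 except for a single vertex of degree 2 (the root). A carving decomposition of a graph $G$ is an unrooted binary tree $T$ with $\mathcal{L}(T) = \mathcal{V}(G)$; for each arc $a$ of $T$, deleting $a$ splits the leaves into two sets $C_a$ and $\mathcal{V}(G)\setminus C_a$, and the width of $T$ is $\max_{a} |(\bigcup_{v \in C_a}\delta_G(v)) \cap (\bigcup_{v \in \mathcal{V}(G)\setminus C_a}\delta_G(v))|$ (width 0 if $T$ has no arcs). Tensors: each index has a finite domain; a tensor $A$ over a finite index set $\mathcal{I}(A)$ is a complex-valued function on assignments to $\mathcal{I}(A)$, with rank $|\mathcal{I}(A)|$. A tensor network $N$ is a nonempty finite set of tensors in which no index appears more than twice; $\mathcal{F}(N)$ are the indices appearing once (free), $\mathcal{B}(N)$ those appearing twice (bond). The contraction of $N$ is a tensor over $\mathcal{F}(N)$ (obtained by multiplying all tensors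 and summing over all bond indices), so it has rank $|\mathcal{F}(N)|$. A contraction tree for $N$ is a rooted binary tree $T$ with $\mathcal{L}(T) = N$. For a node $n$ of $T$, let $T_n$ be the subtree consisting of $n$ and its descendants; the max rank of $T$ is $\max_{n \in \mathcal{V}(T)} |\mathcal{F}(\mathcal{L}(T_n))|$, i.e. the maximum rank of the contraction of the set of tensors below any node (these are exactly the intermediate tensors computed when contracting $N$ recursively along $T$). The structure graph of $N$ is the graph with vertex set $N \sqcup \{z\}$ ($z$ a fresh free vertex), edge set $\mathcal{B}(N) \cup \mathcal{F}(N)$, $\delta_G(A) = \mathcal{I}(A)$ for $A \in N$ and $\delta_G(z) = \mathcal{F}(N)$. *)

(* Defs.v *)
From mathcomp Require Import all_boot all_order all_algebra.
From mathcomp Require Import finmap complex boolp reals.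

Set Implicit Arguments.
Unset Strict Implicit.
Unset Printing Implicit Defensive.

(** * Graphs and trees *)

(* Multiple edges are allowed; every edge has exactly two endpoints, so there
   are no loops. *)
Record graph := Graph {
  vertex :> finType;
  edge : finType;
  delta : vertex -> {set edge};
  graph_nonempty : 0 < #|vertex|;
  graph_two_ends : forall e : edge, #|[set v | e \in delta v]| = 2
}.

Section GraphTheory.
Variable G : graph.

Definition ends (e : edge G) : {set G} := [set v | e \in delta v].

Definition degree (v : G) : nat := #|delta v|.

(* Adjacency in the subgraph whose edge set is [F]. *)
Definition adj_in (F : {set edge G}) : rel G :=
  [rel x y | (x != y) && [exists e in F, (e \in delta x) && (e \in delta y)]].

Definition adj : rel G := adj_in [set: edge G].

Definition simple_graph : Prop := injective ends.

Definition connected_graph : Prop := forall x y : G, connect adj x y.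

(* Cycles of length two would be pairs of parallel edges, which
   [simple_graph] excludes. *)
Definition acyclic_graph : Prop :=
  forall s : seq G, 2 < size s -> ~ ucycle adj s.

Definition is_tree : Prop :=
  [/\ simple_graph, connected_graph & acyclic_graph].

(* The only vertex of a one-vertex tree has degree zero; it counts as a leaf,
   so that a one-vertex rooted binary tree has one leaf. *)
Definition leaves : {set G} := [set v | (degree v == 1) || (#|G| == 1)].

Definition unrooted_binary_tree : Prop :=
  is_tree /\ (forall v : G, degree v = 1 \/ degree v = 3).

Definition rooted_binary_tree (r : G) : Prop :=
  is_tree /\
  (#|G| = 1 \/
   (degree r = 2 /\ forall v : G, v != r -> degree v = 1 \/ degree v = 3)).

(* In a tree rooted at [r], [m] is [n] or a descendant of [n] when [n] lies on
   the path from [r] to [m]. *)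
Definition below (r n m : G) : Prop :=
  exists p : seq G,
    [/\ path adj r p, uniq (r :: p), last r p = m & n \in r :: p].

End GraphTheory.

(** * Carving decompositions *)

(* The equality between the leaves of the tree and the vertices of [G] is a
   bijection [cd_leaf]. *)
Record carving_decomposition (G : graph) := CarvingDecomposition {
  cd_tree :> graph;
  cd_binary : unrooted_binary_tree cd_tree;
  cd_leaf : G -> cd_tree;
  cd_leaf_inj : injective cd_leaf;
  cd_leaves : cd_leaf @: [set: G] = leaves cd_tree
}.

Section Width.
Variables (G : graph) (T : carving_decomposition G).

(* The vertices of [G] whose leaf remains connected to the endpoint [x] of the
   arc [a] once [a] is deleted. *)
Definition carve (a : edge T) (x : T) : {set G} :=
  [set v | connect (adj_in [set~ a]) x (cd_leaf T v)].

Definition cut (C : {set G}) : {set edge G} :=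
  (\bigcup_(v in C) delta v) :&: (\bigcup_(v in ~: C) delta v).

(* The two endpoints of [a] give complementary sets [carve a x], hence the same
   cut: the inner maximum is over two equal numbers. *)
Definition width : nat :=
  \max_(a : edge T) \max_(x in ends a) #|cut (carve a x)|.

End Width.

(** * Tensor networks *)

Section Tensors.
Local Open Scope fset_scope.
Variables (R : realType) (I : choiceType) (dom : I -> finType).

Definition tensor : choiceType :=
  {A : {fset I} & {ffun {dffun forall i : A, dom (val i)} -> R[i]}}.

Definition indices (A : tensor) : {fset I} := tag A.

Definition occurrences (S : {fset tensor}) (i : I) : nat :=
  #|` [fset A in S | i \in indices A]|.

Definition all_indices (S : {fset tensor}) : {fset I} :=
  \bigcup_(A <- S) indices A.

Definition free_indices (S : {fset tensor}) : {fset I} :=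
  [fset i in all_indices S | occurrences S i == 1%N].

Definition bond_indices (S : {fset tensor}) : {fset I} :=
  [fset i in all_indices S | occurrences S i == 2].

Record tensor_network := TensorNetwork {
  tensors :> {fset tensor};
  tn_nonempty : tensors != fset0;
  tn_le2 : forall i : I, (occurrences tensors i <= 2)%N
}.

(** * Contraction trees *)

Record contraction_tree (N : tensor_network) := ContractionTree {
  ct_tree :> graph;
  ct_root : ct_tree;
  ct_binary : rooted_binary_tree ct_root;
  ct_leaf : N -> ct_tree;
  ct_leaf_inj : injective ct_leaf;
  ct_leaves : ct_leaf @: [set: N] = leaves ct_tree
}.

Definition tensors_below (N : tensor_network) (T : contraction_tree N)
    (n : T) : {fset tensor} :=
  [fset val A | A in [set A : N | `[< below (ct_root T) n (ct_leaf T A) >]]].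

Definition max_rank (N : tensor_network) (T : contraction_tree N) : nat :=
  \max_(n : T) #|` free_indices (tensors_below n)|.

(** * The structure graph *)

Section StructureGraph.
Variable N : tensor_network.

Definition sg_edge : finType :=
  fset_sub_type (bond_indices N `|` free_indices N).

(* [None] is the free vertex. *)
Definition sg_delta (v : option N) : {set sg_edge} :=
  if v is Some A then [set e | val e \in indices (val A)]
  else [set e | val e \in free_indices N].

Lemma card_occurrences (i : I) :
  #|[set A : N | i \in indices (val A)]| = occurrences N i.
Proof.
rewrite /occurrences.
have -> : [fset A in tensors N | i \in indices A] =
          [fset val A | A in [set A : N | i \in indices (val A)]].
  apply/fsetP => A; rewrite !inE /=; apply/andP/imfsetP => [[AN iA] | [B]].
    by exists [` AN]; rewrite //= inE.
  by rewrite /= inE => iB ->; split=> //; apply: valP.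
by rewrite card_imfset /= -?cardE //; apply: val_inj.
Qed.

Lemma sg_two_ends (e : sg_edge) : #|[set v | e \in sg_delta v]| = 2.
Proof.
have := valP e; rewrite !inE -/(occurrences N (val e)).
rewrite (cardsD1 None) inE /=.
have -> : [set v | e \in sg_delta v] :\ None =
          Some @: [set A : N | val e \in indices (val A)].
  apply/setP => -[A|]; rewrite !inE /= ?inE ?(mem_imset _ _ Some_inj) ?inE //.
  by apply/esym/negbTE/negP => /imsetP[].
rewrite card_imset ?card_occurrences; last exact: Some_inj.
by rewrite !inE; case/orP => /andP[-> /eqP ->].
Qed.

Lemma sg_nonempty : 0 < #|{: option N}|.
Proof. by rewrite card_option. Qed.

Definition structure_graph : graph := Graph sg_nonempty sg_two_ends.

End StructureGraph.
End Tensors.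

(** * Random access machines *)

(* Unit-cost random access machine.  Programs are finite, so only finitely many
   registers are in use; the memory is addressed indirectly through registers
   and subtraction is truncated.  There is no multiplication. *)
Inductive instr :=
| IConst (r k : nat)    (* r := k *)
| IAdd (r s t : nat)    (* r := s + t *)
| ISub (r s t : nat)    (* r := s - t *)
| ILoad (r s : nat)     (* r := memory[s] *)
| IStore (r s : nat)    (* memory[r] := s *)
| IJumpz (r l : nat).   (* if r = 0 then jump to instruction l *)

Definition program := seq instr.

Record state := State {
  counter : nat;
  register : nat -> nat;
  memory : nat -> nat
}.

Definition update (f : nat -> nat) (a v : nat) : nat -> nat :=
  fun x => if x == a then v else f x.

Definition exec (i : instr) (s : state) : state :=
  let: State c g m := s in
  match i with
  | IConst r k => State c.+1 (update g r k) m
  | IAdd r a b => State c.+1 (update g r (g a + g b)) m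
  | ISub r a b => State c.+1 (update g r (g a - g b)) m
  | ILoad r a => State c.+1 (update g r (m (g a))) m
  | IStore r a => State c.+1 g (update m (g r) (g a))
  | IJumpz r l => State (if g r == 0 then l else c.+1) g m
  end.

(* The machine halts when the counter leaves the program. *)
Definition halted (p : program) (s : state) : bool := size p <= counter s.

Definition step (p : program) (s : state) : state :=
  if onth p (counter s) is Some i then exec i s else s.

Definition initial (m : nat -> nat) : state := State 0 (fun=> 0) m.

(* [p], started on memory [m], halts after at most [t] steps with memory [m']. *)
Definition computes (p : program) (m : nat -> nat) (t : nat) (m' : nat -> nat)
    : Prop :=
  exists2 k, k <= t &
    halted p (iter k (step p) (initial m)) /\
    memory (iter k (step p) (initial m)) = m'.

(** * Trees in memory *)

(* A tree of maximum degree three whose leaves are identified with the elements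
   of [X] is stored as an adjacency table.  Vertices are represented by positive
   numbers: the leaf of [x] by the prescribed number [name x], the other vertices
   by distinct numbers between [lo] and [hi].  The vertex with number [k] has its
   row at addresses [3k], [3k+1], [3k+2]; the nonzero entries of the row are the
   numbers of its neighbours, each appearing once, in any order.  The rest of the
   memory is arbitrary. *)
Definition row (m : nat -> nat) (k : nat) : seq nat :=
  [seq a <- [:: m (3 * k); m (3 * k).+1; m (3 * k).+2] | a != 0].

Definition numbering (T : graph) (X : Type) (leaf : X -> T) (name : X -> nat)
    (lo hi : nat) (num : T -> nat) : Prop :=
  [/\ injective num,
      forall x : X, num (leaf x) = name x &
      forall v : T, v \notin leaves T -> lo <= num v <= hi].

Definition stores_tree (T : graph) (num : T -> nat) (m : nat -> nat) : Prop :=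
  forall v : T, perm_eq (row m (num v)) [seq num u | u <- enum (adj v)].

Section Encodings.
Variables (R : realType) (I : choiceType) (dom : I -> finType).
Variables (N : tensor_network R dom) (nu : N -> 'I_#|` N|).

(* The free vertex has number 1, the tensors have numbers 2, ..., |N| + 1 in the
   order given by [nu], and the internal vertices of either tree have numbers
   |N| + 2, ..., 2|N|: a contraction tree for [N] and a carving decomposition of
   the structure graph of [N] both have |N| - 1 vertices that are not leaves. *)
Definition tensor_number (A : N) : nat := (nu A).+2.

Definition vertex_number (v : structure_graph N) : nat :=
  if v is Some A then tensor_number A else 1.

(* Row 0 belongs to no vertex; address 0 holds the number of the root. *)
Definition stores_contraction_tree (T : contraction_tree N) (m : nat -> nat)
    : Prop :=
  exists num : T -> nat,
    [/\ numbering (ct_leaf T) tensor_number (#|` N| + 2) (2 * #|` N|) num,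
        stores_tree num m &
        m 0 = num (ct_root T)].

Definition stores_carving_decomposition
    (T : carving_decomposition (structure_graph N)) (m : nat -> nat) : Prop :=
  exists num : T -> nat,
    numbering (cd_leaf T) vertex_number (#|` N| + 2) (2 * #|` N|) num /\
    stores_tree num m.

End Encodings.

(* Main.v *)
Require Import Defs.
From mathcomp Require Import all_boot all_order all_algebra.
From mathcomp Require Import finmap complex boolp reals zify.

(* Contraction trees and carving decompositions of the structure graph are the
   same trees, up to one vertex: hanging the free vertex on the root of a
   contraction tree gives a carving decomposition, and removing the free vertex
   (a leaf) from a carving decomposition gives a contraction tree rooted at the
   neighbour of that leaf. Under this correspondence every node [n] of the
   contraction tree has exactly one arc towards the free vertex; the leaves on
   its far side are the tensors below [n], and the cut of this arc consists of
   the indices that occur exactly once among them. In memory the two trees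
   differ only in the row of the root and the row of the free vertex, so a
   bounded number of machine steps converts one into the other. *)

Set Implicit Arguments.
Unset Strict Implicit.
Unset Printing Implicit Defensive.

(** * Bridges and descendants *)

Lemma connect_uniq (V : finType) (R : rel V) (x y : V) : connect R x y ->
  exists p, [/\ path R x p, uniq (x :: p) & last x p = y].
Proof. by case/connectP => p /shortenP[q Rq uq _] ->; exists q. Qed.

Section Bridges.
Variable G : graph.
Implicit Types (F : {set edge G}) (e : edge G) (x y r n m : G).

Lemma adj_inP F x y :
  reflect (x != y /\ exists e, [/\ e \in F, e \in delta x & e \in delta y])
          (adj_in F x y).
Proof.
apply: (iffP andP) => -[-> h]; split=> //.
  by case/existsP: h => e /and3P[]; exists e.
by case: h => e [eF ex ey]; apply/existsP; exists e; rewrite eF ex.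
Qed.

Lemma adj_in_sym F : symmetric (adj_in F).
Proof.
by move=> x y; apply/adj_inP/adj_inP => -[xy [e [? ? ?]]];
  (split; [rewrite eq_sym | exists e]).
Qed.

Lemma connect_adj_in_sym F : connect_sym (adj_in F).
Proof. exact/sym_connect_sym/adj_in_sym. Qed.

Lemma sub_adj_in F F' : F \subset F' -> subrel (adj_in F) (adj_in F').
Proof.
move=> /subsetP FF' x y /adj_inP[xy [e [eF ex ey]]].
by apply/adj_inP; split=> //; exists e; rewrite FF'.
Qed.

Lemma ends_pair e x y :
  x != y -> e \in delta x -> e \in delta y -> ends e = [set x; y].
Proof.
move=> xy ex ey; apply/esym/eqP; rewrite eqEcard cards2 xy graph_two_ends andbT.
by apply/subsetP => v /set2P[] ->; rewrite inE.
Qed.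

Lemma ends_delta e x y :
  ends e = [set x; y] -> e \in delta x /\ e \in delta y.
Proof.
move=> E; have : x \in ends e /\ y \in ends e by rewrite E set21 set22.
by rewrite !inE.
Qed.

Lemma edge_ends e :
  exists x y, x != y /\ ends e = [set x; y].
Proof. by have /eqP/cards2P[x [y [xy E]]] := graph_two_ends e; exists x, y. Qed.

(** Crossing [e] visits both of its ends, so a path that misses one of them never uses [e]. *)
Lemma path_avoid e u n :
  ends e = [set u; n] ->
  forall x (q : seq G), u \notin x :: q \/ n \notin x :: q ->
  path (@adj G) x q -> path (adj_in [set~ e]) x q.
Proof.
move=> E x q; elim: q x => //= y q IH x H /andP[/adj_inP[xy [e' [_ ex ey]]] yq].
rewrite IH //; last by case: H; rewrite inE => /norP[_]; [left|right].
rewrite andbT; apply/adj_inP; split=> //; exists e'; split=> //.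
rewrite !inE; apply/eqP => ee'; subst e'.
have := ends_pair xy ex ey; rewrite E => E'.
have : u \in [set x; y] /\ n \in [set x; y] by rewrite -E' set21 set22.
rewrite !inE => -[/orP[]/eqP h1 /orP[]/eqP h2]; move: H;
  by rewrite h1 h2 !inE !eqxx ?orbT /=; case.
Qed.

(* [e] would close a path around it into a cycle, of length at least three
   because no edge is parallel to [e]. *)
Lemma tree_bridge e x y :
  is_tree G -> ends e = [set x; y] -> x != y ->
  ~~ connect (adj_in [set~ e]) x y.
Proof.
case=> simp _ acyc E xy; apply/negP => /connect_uniq[p [Rp up lp]].
have [ex ey] := ends_delta E.
apply: (acyc (x :: p)).
  case: p Rp lp up => [_ /= xy'|v [|//]] /=.
    by rewrite xy' eqxx in xy.
  rewrite andbT => /adj_inP[_ [e' [e'e e'x e'v]]] vy; subst v.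
  have := ends_pair xy e'x e'v; rewrite -E => /simp ee'.
  by move: e'e; rewrite ee' !inE eqxx.
apply/andP; split; last by [].
rewrite /= rcons_path lp (sub_path _ Rp) /=; last exact/sub_adj_in/subsetT.
by apply/adj_inP; split; [rewrite eq_sym | exists e].
Qed.

(** Walk from [w] towards [x]: when the walk is first about to cross [e], it stands at one of the
    two ends of [e]. *)
Lemma connect_avoid e x y w :
  ends e = [set x; y] -> connect (@adj G) w x ->
  connect (adj_in [set~ e]) w x || connect (adj_in [set~ e]) w y.
Proof.
move=> E /connectP[p]; elim: p w => [|v p IH] w /=.
  by move=> _ ->; rewrite connect0.
case/andP => /adj_inP[wv [e' [_ ew ev]]] vp lp.
have [ee'|ee'] := eqVneq e' e.
  subst e'; have : w \in ends e by rewrite inE.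
  by rewrite E => /set2P[] ->; rewrite connect0 ?orbT.
have wv' : adj_in [set~ e] w v.
  by apply/adj_inP; split=> //; exists e'; rewrite !inE.
by case/orP: (IH _ vp lp) => h; rewrite (connect_trans (connect1 wv') h) ?orbT.
Qed.

(* [e] joins [n] to its parent [p] in the tree rooted at [r]. *)
Definition parent_arc r e p n :=
  [/\ ends e = [set p; n], p != n & connect (adj_in [set~ e]) r p].

Hypothesis treeG : is_tree G.

(** The path from [r] to a vertex below [n] enters [n] through its parent arc and never crosses that
    arc again. This turns descendants into a component of the tree without the arc, the form in
    which carvings are defined. *)
Lemma below_parent_arc r e p n m :
  parent_arc r e p n -> below r n m <-> connect (adj_in [set~ e]) n m.
Proof.
move=> [E pn rp]; have brid := tree_bridge treeG E pn.
have sub : subrel (adj_in [set~ e]) (@adj G) by apply/sub_adj_in/subsetT.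
split=> [[q [Rq uq lq]]|].
  rewrite inE => /orP[/eqP nr|].
    by subst r; rewrite connect_adj_in_sym rp in brid.
  move=> /splitPr nq; case: nq Rq uq lq => q1 q2.
  rewrite cat_path last_cat /= => /and3P[Rq1 ln Rq2] uq lq.
  (* If [p] came after [n], the part of the path up to [n] would miss [p] and hence avoid [e]; then
     [e] would not be a bridge. *)
  have [pq2|pq2] := boolP (p \in q2).
    suff rn : connect (adj_in [set~ e]) r n.
      by rewrite connect_adj_in_sym in rp; rewrite (connect_trans rp rn) in brid.
    apply/connectP; exists (rcons q1 n); last by rewrite last_rcons.
    apply: (path_avoid E); last by rewrite rcons_path Rq1.
    left; apply/negP; rewrite -rcons_cons mem_rcons inE (negPf pn) /= => pq1.
    move: uq; rewrite -[_ && _]/(uniq ((r :: q1) ++ n :: q2)) cat_uniq.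
    move/and3P => [_ /hasPn/(_ p)].
    by rewrite inE pq2 orbT => /(_ isT); rewrite /= pq1.
  apply/connectP; exists q2 => //; apply: (path_avoid E) => //.
  by left; rewrite inE negb_or pn.
move=> nm; have [s [Rs us ls]] := connect_uniq rp.
have [q [Rq uq lq]] := connect_uniq nm.
exists (s ++ n :: q); split.
- rewrite cat_path (sub_path sub Rs) /= ls (sub_path sub Rq) andbT.
  by have [ep en] := ends_delta E; apply/adj_inP; split=> //; exists e; rewrite inE.
(* A vertex on both halves would join [n] to [p] without the bridge [e]. *)
- rewrite -cat_cons cat_uniq us uq andbT; apply/hasPn => y yq; apply/negP => /= ys.
  have ry := path_connect Rs ys; have ny := path_connect Rq yq.
  move/negP: brid; apply; rewrite connect_adj_in_sym.
  rewrite connect_adj_in_sym in ry.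
  exact: connect_trans ny (connect_trans ry rp).
- by rewrite last_cat /=.
- by rewrite -cat_cons mem_cat mem_head orbT.
Qed.

(** The arc is the last edge of the simple path from [r] to [n]; the rest of this path misses [n],
    hence avoids the arc. *)
Lemma parent_arc_of_vertex r n : n != r -> exists e p, parent_arc r e p n.
Proof.
move=> nr; case: treeG => _ /(_ r n)/connect_uniq[q [Rq uq lq]] _.
case/lastP: q Rq uq lq => [|q y] Rq uq; first by move=> /= rn; rewrite rn eqxx in nr.
rewrite last_rcons => yn; subst y.
move: Rq; rewrite rcons_path => /andP[Rq /adj_inP[pn [e [_ ep en]]]].
have E := ends_pair pn ep en.
exists e, (last r q); split=> //; apply/connectP; exists q => //.
apply: (path_avoid E) => //; right.
by move: uq; rewrite -rcons_cons rcons_uniq => /andP[].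
Qed.

Lemma parent_arc_of_edge r e : exists p n, parent_arc r e p n.
Proof.
have [x [y [xy E]]] := edge_ends e.
have [_ conn _] := treeG.
case/orP: (connect_avoid E (conn r x)) => h; first by exists x, y.
by exists y, x; split=> //; rewrite 1?setUC // eq_sym.
Qed.

Lemma parent_arc_neq_root r e p n : parent_arc r e p n -> n != r.
Proof.
case=> E pn rp; apply: contraNneq (tree_bridge treeG E pn) => ->.
by rewrite connect_adj_in_sym.
Qed.

(** Deleting [e] leaves two components: [connect_avoid] puts [m] in at least one of them, and the
    bridge property in at most one. *)
Lemma connect_parent_arc r e p n m : parent_arc r e p n ->
  connect (adj_in [set~ e]) p m = ~~ connect (adj_in [set~ e]) n m.
Proof.
case=> E pn rp; have brid := tree_bridge treeG E pn.
have [_ conn _] := treeG; have := connect_avoid E (conn m p).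
rewrite ![connect _ m _]connect_adj_in_sym.
case pm: (connect _ p m); case nm: (connect _ n m) => //=.
rewrite connect_adj_in_sym in nm.
by rewrite (connect_trans pm nm) in brid.
Qed.

End Bridges.

(** * Pendant vertices *)

Lemma card1_all_equal (T : finType) : #|T| = 1 -> forall x y : T, x = y.
Proof. by move=> T1 x y; apply: (fintype_le1P _); rewrite T1. Qed.

Lemma degree_card1 (K : graph) (v : K) : #|K| = 1 -> degree v = 0.
Proof.
move=> K1; apply/eqP; rewrite cards_eq0; apply/set0Pn => -[e _].
have [a [b [/eqP ab _]]] := edge_ends e.
by apply: ab; apply: card1_all_equal.
Qed.

(* [G] is [H] with a pendant vertex [z] attached to [r] by the edge [e0]. *)
Record pendant (H G : graph) (r : H) (z : G) (f : H -> G)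
    (g : edge H -> edge G) (e0 : edge G) : Prop := Pendant {
  vertex_inj : injective f;
  edge_inj : injective g;
  vertex_neq : forall v, f v != z;
  edge_neq : forall e, g e != e0;
  vertex_onto : forall x, x != z -> exists v, x = f v;
  edge_onto : forall e, e != e0 -> exists e', e = g e';
  delta_pendant : delta z = [set e0];
  delta_edge : forall v e, (g e \in delta (f v)) = (e \in delta v);
  delta_pendant_edge : forall v, (e0 \in delta (f v)) = (v == r)
}.

Section Pendant.
Variables (H G : graph) (r : H) (z : G) (f : H -> G) (g : edge H -> edge G).
Variable e0 : edge G.
Hypothesis P : pendant r z f g e0.
Implicit Types (u v n : H) (x y : G).

Let f_inj := vertex_inj P.
Let g_inj := edge_inj P.

Let z_neq v : (z == f v) = false.
Proof. by rewrite eq_sym; apply/negbTE/(vertex_neq P). Qed.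

Lemma pendant_delta v :
  delta (f v) = g @: delta v :|: (if v == r then [set e0] else set0).
Proof.
apply/setP => e; rewrite !inE; have [->|/(edge_onto P)[e' ->]] := eqVneq e e0.
  rewrite (delta_pendant_edge P); case: (v == r); rewrite !inE ?eqxx ?orbT ?orbF //.
  by symmetry; apply/negbTE/imsetP => -[e' _ /eqP]; rewrite eq_sym (negPf (edge_neq P e')).
rewrite (delta_edge P) mem_imset //; case: (v == r); rewrite !inE ?orbF //.
by rewrite (negPf (edge_neq P e')) orbF.
Qed.

Lemma pendant_degree v : degree (f v) = degree v + (v == r).
Proof.
rewrite /degree pendant_delta cardsU card_imset //.
rewrite (_ : _ :&: _ = set0) ?cards0 ?subn0; last first.
  apply/setP => e; rewrite !inE; case: (v == r); rewrite !inE ?andbF //.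
  by apply/andP => -[/imsetP[e' _ ->]]; rewrite (negPf (edge_neq P e')).
by case: (v == r); rewrite ?cards1 ?cards0.
Qed.

Lemma degree_pendant : degree z = 1.
Proof. by rewrite /degree (delta_pendant P) cards1. Qed.

Lemma card_pendant : #|G| = #|H|.+1.
Proof.
rewrite -(card_imset predT f_inj) -[#|G|]cardsT (cardsD1 z) inE add1n.
congr _.+1; apply: eq_card => x; rewrite !inE andbT.
apply/idP/imsetP => [/(vertex_onto P)[v ->]|[v _ ->]]; first by exists v.
exact: vertex_neq P v.
Qed.

Lemma pendant_ends e : ends (g e) = f @: ends e.
Proof.
apply/setP => x; rewrite inE; have [->|/(vertex_onto P)[v ->]] := eqVneq x z.
  rewrite (delta_pendant P) inE (negPf (edge_neq P e)).
  by apply/esym/negbTE/imsetP => -[v _ /eqP]; rewrite z_neq.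
by rewrite mem_imset // inE (delta_edge P).
Qed.

Lemma ends_pendant_edge : ends e0 = [set z; f r].
Proof.
apply: ends_pair; first by rewrite eq_sym (vertex_neq P).
  by rewrite (delta_pendant P) set11.
by rewrite (delta_pendant_edge P).
Qed.

Lemma pendant_adj u v : adj (f u) (f v) = adj u v.
Proof.
apply/adj_inP/adj_inP => [[fuv [e [_ eu ev]]]|[uv [e [_ eu ev]]]].
  have uv : u != v by apply: contraNneq fuv => ->.
  split=> //; have [ee0|/(edge_onto P)[e' ee']] := eqVneq e e0.
    move: eu ev uv; rewrite ee0 !(delta_pendant_edge P) => /eqP -> /eqP ->.
    by rewrite eqxx.
  by move: eu ev; rewrite ee' !(delta_edge P) => eu ev; exists e'; rewrite inE.
split; first by rewrite (inj_eq f_inj).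
by exists (g e); rewrite !(delta_edge P) inE.
Qed.

Lemma adj_pendant v : adj z (f v) = (v == r).
Proof.
apply/adj_inP/eqP => [[_ [e [_]]]|->].
  by rewrite (delta_pendant P) => /set1P ->; rewrite (delta_pendant_edge P) => /eqP.
split; first by rewrite eq_sym (vertex_neq P).
by exists e0; rewrite (delta_pendant P) (delta_pendant_edge P) !inE.
Qed.

Lemma adj_sym (K : graph) : symmetric (@adj K).
Proof. exact: adj_in_sym. Qed.

Lemma mem_enum_adj (K : graph) (x y : K) : (y \in enum (adj x)) = adj x y.
Proof. by rewrite mem_enum. Qed.

(** Collapsing [z] onto its neighbour projects the walks of [G] to walks of [H]. It also serves to
    extend a numbering of [H] to [G]. *)
Lemma pendant_retraction : exists h : G -> H, cancel f h /\ h z = r.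
Proof.
exists (fun x => odflt r [pick v | f v == x]); split=> [v|].
  case: pickP => [u /eqP/f_inj //|/(_ v)]; by rewrite eqxx.
by case: pickP => // v; rewrite (negPf (vertex_neq P v)).
Qed.

Lemma pendant_connected : connected_graph H <-> connected_graph G.
Proof.
split=> conn.
  have fconn u v : connect (@adj G) (f u) (f v).
    have /connectP[p Rp ->] := conn u v; apply/connectP; exists (map f p).
      by rewrite path_map; apply: sub_path Rp => a b /=; rewrite pendant_adj.
    by rewrite last_map.
  have zr : connect (@adj G) z (f r) by apply: connect1; rewrite adj_pendant.
  have zconn v : connect (@adj G) z (f v) := connect_trans zr (fconn r v).
  move=> x y; have [->|/(vertex_onto P)[u ->]] := eqVneq x z;
    have [->|/(vertex_onto P)[v ->]] := eqVneq y z => //.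
  by rewrite connect_adj_in_sym.
have [h [fK hz]] := pendant_retraction.
have hadj x y : adj x y -> connect (@adj H) (h x) (h y).
  have [->|/(vertex_onto P)[u ->]] := eqVneq x z;
    have [->|/(vertex_onto P)[v ->]] := eqVneq y z; rewrite ?fK ?hz //.
  - by rewrite adj_pendant => /eqP ->.
  - by rewrite adj_sym adj_pendant => /eqP ->.
  - by rewrite pendant_adj; apply: connect1.
move=> u v; rewrite -[u]fK -[v]fK; move: (f u) (f v) (conn (f u) (f v)) => x y.
case/connectP => p; elim: p x => [|w p IH] x /=; first by move=> _ ->.
by case/andP => /hadj hxw wp /(IH _ wp); apply: connect_trans.
Qed.

Lemma pendant_image (s : seq G) : z \notin s -> exists t, s = map f t.
Proof.
elim: s => [|x s IH]; first by exists [::].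
rewrite inE negb_or => /andP[zx /IH[t ->]].
by move: zx; rewrite eq_sym => /(vertex_onto P)[v ->]; exists (v :: t).
Qed.

Lemma pendant_cycle (t : seq H) : cycle (@adj G) (map f t) = cycle (@adj H) t.
Proof.
case: t => //= u t; rewrite -map_rcons path_map.
by apply: eq_path => a b /=; rewrite pendant_adj.
Qed.

(** No cycle passes through [z]: its two neighbours on the cycle would both be [f r], whereas a
    cycle of length at least three has distinct vertices. *)
Lemma pendant_acyclic : acyclic_graph H <-> acyclic_graph G.
Proof.
split=> acyc s sz /andP[cs us]; last first.
  apply: (acyc (map f s)); first by rewrite size_map.
  by apply/andP; rewrite pendant_cycle map_inj_uniq.
have [zs|/pendant_image[t st]] := boolP (z \in s); last first.
  move: sz cs us; rewrite st size_map pendant_cycle map_inj_uniq // => sz ct ut.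
  by apply: (acyc t sz); apply/andP.
(* Rotate the cycle to start at [z], so that the neighbours of [z] are the second and the last
   vertex. *)
have [i s' ss'] := rot_to zs.
have {cs} : cycle (@adj G) (z :: s') by rewrite -ss' rot_cycle.
have {us} : uniq (z :: s') by rewrite -ss' rot_uniq.
have {sz} : 2 < size (z :: s') by rewrite -ss' size_rot.
rewrite /=; case: s' {ss'} => // y s' sz /andP[zs' ys'].
rewrite rcons_path => /andP[/= /andP[zy _]].
have fr x : adj z x -> x = f r.
  have [->|/(vertex_onto P)[v ->]] := eqVneq x z.
    by case/adj_inP; rewrite eqxx.
  by rewrite adj_pendant => /eqP ->.
rewrite adj_sym => /fr; rewrite (fr _ zy) in ys' *.
case/lastP: s' sz zs' ys' => // s' w _ _; rewrite last_rcons => + wr.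
by rewrite wr /= mem_rcons mem_head.
Qed.

Lemma pendant_simple : simple_graph H <-> simple_graph G.
Proof.
split=> simp e e'; last first.
  by move=> ee'; apply/g_inj/simp; rewrite !pendant_ends ee'.
have ne0 a : ends (g a) != ends e0.
  apply/eqP => /setP/(_ z); rewrite ends_pendant_edge pendant_ends set21.
  by by case/imsetP => v _ /eqP; rewrite z_neq.
have [->|/(edge_onto P)[a ->]] := eqVneq e e0;
  have [->|/(edge_onto P)[a' ->]] := eqVneq e' e0 => //.
- by move/esym/eqP; rewrite (negPf (ne0 a')).
- by move/eqP; rewrite (negPf (ne0 a)).
- by rewrite !pendant_ends => /(imset_inj f_inj)/simp ->.
Qed.

Lemma pendant_tree : is_tree H <-> is_tree G.
Proof.
by split=> -[? ? ?]; split; apply/pendant_simple || apply/pendant_connected ||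
  apply/pendant_acyclic.
Qed.

(** Only the degree of the root changes: from 2 to 3, or from 0 to 1 when the rooted tree is a
    single vertex. *)
Lemma pendant_binary : rooted_binary_tree r <-> unrooted_binary_tree G.
Proof.
split=> [[tree bin]|[tree bin]]; split; try exact/pendant_tree.
  move=> x; have [->|/(vertex_onto P)[v ->]] := eqVneq x z.
    by left; apply: degree_pendant.
  rewrite pendant_degree; case: bin => [H1|[dr dv]]; last first.
    have [->|/dv] := eqVneq v r; first by right; rewrite dr.
    by rewrite addn0.
  by left; rewrite degree_card1 // (card1_all_equal H1 v r) eqxx.
have dr := bin (f r); rewrite pendant_degree eqxx addn1 in dr.
case: dr => -[dr]; last first.
  right; split=> // v vr; have := bin (f v).
  by rewrite pendant_degree (negPf vr) addn0.
(* A root of degree zero is isolated, so connectedness makes it the only vertex. *)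
left; apply/eqP; rewrite eqn_leq (graph_nonempty H) andbT.
apply/fintype_le1P => u v.
have /pendant_tree[_ conn _] := tree.
suff all_r w : w = r by rewrite (all_r u) (all_r v).
have /connectP[[|y p] /=] := conn r w; first by [].
case/andP => /adj_inP[_ [e [_ er _]]].
by move/eqP: dr; rewrite cards_eq0 => /eqP dr; rewrite dr inE in er.
Qed.

(** The root is the delicate vertex. Alone in [H], it is a leaf by convention there and by its
    degree in [G]; otherwise it is a leaf of neither. *)
Lemma pendant_leaves : rooted_binary_tree r -> leaves G = z |: f @: leaves H.
Proof.
move=> bin; have [_ dG] := pendant_binary.1 bin.
apply/setP => x; rewrite !inE card_pendant eqSS eqn0Ngt graph_nonempty orbF.
have [->|/(vertex_onto P)[v ->]] := eqVneq x z; first by rewrite degree_pendant.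
rewrite mem_imset // inE pendant_degree /=.
case: bin => _ [H1|[dr _]].
  by rewrite degree_card1 // (card1_all_equal H1 v r) eqxx H1 orbT.
have [->|vr] := eqVneq v r; last first.
  rewrite addn0 (_ : #|H| == 1 = false) ?orbF //.
  by apply: contraNF vr => /eqP H1; apply/eqP/card1_all_equal.
(* A root of degree 2 has an edge, whose two ends show that [H] has more than one vertex. *)
rewrite dr; apply/esym/negbTE; rewrite neq_ltn; apply/orP; right.
have /card_gt0P[e er] : 0 < #|delta r| by rewrite [#|_|]dr.
by rewrite -(graph_two_ends e) max_card.
Qed.

(** The simple paths from [z] to [f v] are those from [r] to [v] with [z] put in front. *)
Lemma pendant_below n v : below r n v <-> below z (f n) (f v).
Proof.
split=> [[p [Rp up lp nrp]]|[p [Rp up lp]]].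
  exists (map f (r :: p)); split.
  - rewrite /= adj_pendant eqxx path_map.
    by apply: sub_path Rp => a b /=; rewrite pendant_adj.
  - rewrite cons_uniq map_inj_uniq // up andbT.
    by apply/mapP => -[w _ /eqP]; rewrite z_neq.
  - by rewrite /= last_map lp.
  - by rewrite inE map_f ?orbT.
rewrite inE (negPf (vertex_neq P n)) /= => np.
move: up; rewrite cons_uniq => /andP[zp up']; have [t pt] := pendant_image zp.
subst p; case: t Rp {zp} up' lp np => // u t.
rewrite map_inj_uniq // mem_map //= adj_pendant => /andP[/eqP -> Rt] ut.
rewrite last_map => /f_inj lt nt; exists t; split=> //.
by move: Rt; rewrite path_map; apply: sub_path => a b /=; rewrite pendant_adj.
Qed.

(** Only the root gains a neighbour; in memory this becomes the change of a single row of [H]. *)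
Lemma pendant_enum_adj v :
  perm_eq (enum (adj (f v)))
          (map f (enum (adj v)) ++ (if v == r then [:: z] else [::])).
Proof.
apply: uniq_perm; first exact: enum_uniq.
  rewrite cat_uniq map_inj_uniq // enum_uniq /=.
  case: (v == r) => //=; rewrite orbF andbT.
  by apply/mapP => -[w _ /eqP]; rewrite z_neq.
move=> x; rewrite mem_enum_adj mem_cat.
have [->|/(vertex_onto P)[u ->]] := eqVneq x z.
  rewrite adj_sym adj_pendant; case: (v == r); rewrite !inE ?eqxx ?orbT ?orbF //.
  by apply/esym/negbTE/mapP => -[w _ /eqP]; rewrite z_neq.
rewrite pendant_adj mem_map // mem_enum_adj.
by case: (v == r); rewrite !inE ?(negPf (vertex_neq P u)) ?orbF.
Qed.

Lemma enum_adj_pendant : enum (adj z) = [:: f r].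
Proof.
apply: perm_small_eq => //; apply: uniq_perm; rewrite ?enum_uniq // => x.
rewrite mem_enum_adj inE; have [->|/(vertex_onto P)[u ->]] := eqVneq x z.
  rewrite eq_sym (negPf (vertex_neq P r)).
  by apply/negbTE/negP => /adj_inP[]; rewrite eqxx.
by rewrite adj_pendant (inj_eq f_inj).
Qed.

End Pendant.

(** * Adding a pendant vertex to a graph *)

Section Attach.
Variables (H : graph) (r : H).

(** [None] is both the new vertex and, among the edges, the new edge. *)
Definition attach_delta (x : option H) : {set option (edge H)} :=
  if x is Some v then Some @: delta v :|: (if v == r then [set None] else set0)
  else [set None].

Lemma attach_delta_Some v e :
  (Some e \in attach_delta (Some v)) = (e \in delta v).
Proof.
rewrite /= inE (mem_imset _ _ Some_inj).
by case: (v == r); rewrite inE orbF.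
Qed.

Lemma attach_delta_None v : (None \in attach_delta (Some v)) = (v == r).
Proof.
rewrite /= inE; case: imsetP => [[] //|_] /=.
by case: (v == r); rewrite inE.
Qed.

Lemma attach_nonempty : 0 < #|{: option H}|.
Proof. by rewrite card_option. Qed.

Lemma attach_two_ends e : #|[set x | e \in attach_delta x]| = 2.
Proof.
case: e => [e|].
  rewrite -(graph_two_ends e) -[RHS](card_imset _ Some_inj); apply: eq_card => -[v|].
    by rewrite inE attach_delta_Some (mem_imset _ _ Some_inj) inE.
  by rewrite !inE; symmetry; apply/negbTE/imsetP => -[].
rewrite (_ : finset _ = [set None; Some r]) ?cards2 //; apply/setP => -[v|].
  by rewrite inE attach_delta_None !inE.
by rewrite !inE.
Qed.

Definition attach : graph := Graph attach_nonempty attach_two_ends.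

Lemma attach_pendant :
  pendant r (None : attach) (Some : H -> attach) (Some : edge H -> edge attach)
    None.
Proof.
split; do 1?[exact: Some_inj] => //.
- by case=> // v _; exists v.
- by case=> // e _; exists e.
- exact: attach_delta_Some.
- exact: attach_delta_None.
Qed.

End Attach.

(** * Removing a vertex of degree one *)

Section Detach.
Variables (G : graph) (z : G) (e0 : edge G).
Hypothesis delta_z : delta z = [set e0].

Definition detach_vertex : finType := {x : G | x != z}.
Definition detach_edge : finType := {e : edge G | e != e0}.

Definition detach_delta (v : detach_vertex) : {set detach_edge} :=
  [set e | val e \in delta (val v)].

(** The root is the end of [e0] other than [z]. *)
Lemma detach_root : exists r : detach_vertex, e0 \in delta (val r).
Proof.
have : 0 < #|ends e0 :\ z|.
  have := cardsD1 z (ends e0); rewrite graph_two_ends inE delta_z set11.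
  by case: #|_ :\ _|.
case/card_gt0P => x; rewrite !inE => /andP[xz e0x].
by exists (exist _ x xz).
Qed.

Lemma detach_nonempty : 0 < #|detach_vertex|.
Proof. by have [r _] := detach_root; apply/card_gt0P; exists r. Qed.

(** Only [e0] ends at [z], so the remaining edges keep both ends. *)
Lemma detach_two_ends e : #|[set v | e \in detach_delta v]| = 2.
Proof.
rewrite -(graph_two_ends (val e)) -[LHS](card_imset _ val_inj).
apply: eq_card => x; rewrite inE; apply/imsetP/idP => [[v]|ex].
  by rewrite !inE => ev ->.
have xz : x != z.
  apply: contraTneq ex => ->; rewrite delta_z inE; exact: valP e.
by exists (exist _ x xz); rewrite ?inE.
Qed.

Definition detach : graph := Graph detach_nonempty detach_two_ends.

Lemma detach_pendant (r : detach) : e0 \in delta (val r) ->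
  pendant r z (val : detach -> G) (val : edge detach -> edge G) e0.
Proof.
move=> e0r; split=> //.
- exact: val_inj.
- exact: val_inj.
- by move=> v; apply: valP v.
- by move=> e; apply: valP e.
- by move=> x xz; exists (exist _ x xz).
- by move=> e ee; exists (exist _ e ee).
- by move=> v e; rewrite inE.
move=> v; apply/idP/eqP => [e0v|-> //].
have rv : ends e0 = [set z; val r].
  apply: ends_pair => //; first by rewrite eq_sym; apply: valP r.
  by rewrite delta_z set11.
have : val v \in ends e0 by rewrite inE.
by rewrite rv !inE (negPf (valP v)) => /eqP/val_inj.
Qed.

End Detach.

(** * Cuts and ranks *)

Section Cuts.
Variable G : graph.

Lemma cutC (C : {set G}) : cut (~: C) = cut C.
Proof. by rewrite /cut setCK setIC. Qed.

(** An edge has two ends, so it meets both sides exactly when one end lies in [C]. *)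
Lemma mem_cut (C : {set G}) (e : edge G) :
  (e \in cut C) = (#|ends e :&: C| == 1).
Proof.
have : #|ends e :&: C| + #|ends e :&: ~: C| = 2.
  by rewrite -setDE cardsID graph_two_ends.
have meets (D : {set G}) : (e \in \bigcup_(v in D) delta v) = (0 < #|ends e :&: D|).
  by apply/bigcupP/card_gt0P => -[v]; [move=> vD ev | rewrite !inE => /andP[ev vD]];
    exists v; rewrite ?inE ?vD ?ev.
rewrite inE !meets; move: #|_| #|_| => [|[|[|a]]] [|[|[|b]]] //=.
Qed.

End Cuts.

Section Ranks.
Variables (R : realType) (I : choiceType) (dom : I -> finType).
Local Open Scope fset_scope.

Lemma mem_all_indices (S : {fset tensor R dom}) i :
  0 < occurrences S i -> i \in all_indices S.
Proof.
rewrite cardfs_gt0 => /fset0Pn[A]; rewrite !inE /= => /andP[AS iA].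
by apply/bigfcupP; exists A; rewrite ?AS.
Qed.

Lemma mem_free_indices (S : {fset tensor R dom}) i :
  (i \in free_indices S) = (occurrences S i == 1%N).
Proof.
by rewrite !inE /= andb_idl // => /eqP occ; rewrite mem_all_indices ?occ.
Qed.

Lemma mem_bond_indices (S : {fset tensor R dom}) i :
  (i \in bond_indices S) = (occurrences S i == 2).
Proof.
by rewrite !inE /= andb_idl // => /eqP occ; rewrite mem_all_indices ?occ.
Qed.

Variable N : tensor_network R dom.

Lemma occurrences_val (S : {set N}) i :
  occurrences [fset val A | A in S] i =
  #|[set A in S | i \in indices (val A)]|.
Proof.
rewrite /occurrences.
have -> : [fset A in [fset val A | A in S] | i \in indices A] =
          [fset val A | A in [set A in S | i \in indices (val A)]].
  apply/fsetP => A; rewrite !inE /=; apply/andP/imfsetP => [[/imfsetP[B BS ->] iB]|[B]].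
    by exists B => //; rewrite /= inE; apply/andP.
  rewrite /= inE => /andP[BS iB] ->; split=> //.
  by apply/imfsetP; exists B.
by rewrite card_imfset /= -?cardE //; apply: val_inj.
Qed.

(** The free vertex is outside the image of [S], so the ends of an edge inside it are the tensors of
    [S] carrying that index. An edge is therefore cut exactly when its index occurs once in [S]. *)
Lemma card_cut_tensors (S : {set N}) :
  #|cut (Some @: S : {set structure_graph N})| =
  #|` free_indices [fset val A | A in S]|.
Proof.
have cutE (e : edge (structure_graph N)) :
    (e \in cut (Some @: S : {set structure_graph N})) =
    (occurrences [fset val A | A in S] (val e) == 1%N).
  rewrite mem_cut occurrences_val; congr (_ == _).
  rewrite -[RHS](card_imset _ Some_inj); apply: eq_card => -[A|]; rewrite !inE.
    by rewrite !(mem_imset _ _ Some_inj) !inE andbC.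
  by rewrite andbC; case: imsetP => [[] //|_]; case: imsetP => [[] //|_].
rewrite (_ : free_indices _ =
    [fset val e | e in cut (Some @: S : {set structure_graph N})]).
  by rewrite card_imfset /= -?cardE //; apply: val_inj.
apply/fsetP => i; rewrite mem_free_indices.
apply/idP/imfsetP => [occ|[e /= + ->]]; last by rewrite cutE.
(* An index occurring once in [S] occurs once or twice in [N], so it is an edge of the structure
   graph. *)
have iN : i \in bond_indices N `|` free_indices N.
  have : occurrences N i != 0.
    rewrite -card_occurrences -lt0n; apply: leq_trans (_ : 0 < 1) _ => //.
    rewrite -(eqP occ) occurrences_val; apply/subset_leq_card/subsetP => A.
    by rewrite !inE => /andP[].
  have := tn_le2 N i; rewrite inE mem_free_indices mem_bond_indices.
  by case: (occurrences N i) => [|[|[|]]].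
by exists [` iN] => //=; rewrite cutE.
Qed.

(** The correspondence is stated as a relation, so that one comparison of rank and width serves both
    directions. *)
Definition hangs_free_vertex (T : contraction_tree N)
    (T' : carving_decomposition (structure_graph N))
    (f : T -> T') (g : edge T -> edge T') (e0 : edge T') : Prop :=
  pendant (ct_root T) (cd_leaf T' None) f g e0 /\
  forall A : N, cd_leaf T' (Some A) = f (ct_leaf T A).

Lemma hang_free_vertex (T : contraction_tree N) :
  exists T' f g e0, @hangs_free_vertex T T' f g e0.
Proof.
have P := attach_pendant (ct_root T).
pose leaf (v : structure_graph N) : attach (ct_root T) :=
  if v is Some A then Some (ct_leaf T A) else None.
have leaf_inj : injective leaf.
  by move=> [A|] [B|] //= [/ct_leaf_inj ->].
have leafE : leaf @: [set: structure_graph N] = leaves (attach (ct_root T)).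
  rewrite (pendant_leaves P (ct_binary T)) -ct_leaves -imset_comp.
  apply/setP => x; rewrite !inE; apply/imsetP/idP => [[[A|] _ ->] //|].
    by apply/orP; right; apply/imsetP; exists A.
  case/orP => [/eqP ->|/imsetP[A _ ->]]; first by exists None.
  by exists (Some A).
pose T' := CarvingDecomposition ((pendant_binary P).1 (ct_binary T)) leaf_inj leafE.
by exists T', Some, Some, None; split.
Qed.

Lemma unhang_free_vertex (T' : carving_decomposition (structure_graph N)) :
  exists T f g e0, @hangs_free_vertex T T' f g e0.
Proof.
have [treeT' degT'] := cd_binary T'; set z := cd_leaf T' None.
(* The convention on one-vertex trees cannot apply: their vertex has degree zero, and here degrees
   are 1 or 3. *)
have degz : degree z = 1.
  have : z \in leaves T' by rewrite -cd_leaves imset_f.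
  rewrite inE => /orP[/eqP //|/eqP T'1].
  by case: (degT' z); rewrite degree_card1.
have /cards1P[e0 delta_z] : #|delta z| == 1%N by rewrite [#|_|]degz.
have [r e0r] := detach_root delta_z.
have P := @detach_pendant _ _ _ delta_z r e0r.
have leaf_neq (A : N) : cd_leaf T' (Some A) != z.
  by rewrite (inj_eq (@cd_leaf_inj _ T')).
pose leaf (A : N) : detach delta_z := Sub (cd_leaf T' (Some A)) (leaf_neq A).
have leaf_inj : injective leaf.
  by move=> A B /(congr1 val) /= /cd_leaf_inj [].
have bin := (pendant_binary P).2 (cd_binary T').
have leafE : leaf @: [set: N] = leaves (detach delta_z).
  apply/setP => v.
  have -> : (v \in leaves (detach delta_z)) = (val v \in leaves T').
    rewrite (pendant_leaves P bin) !inE (negPf (valP v)) /=.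
    by rewrite (mem_imset _ _ val_inj) inE.
  rewrite -cd_leaves; apply/imsetP/imsetP => [[A _ ->]|[[A|] _ vE]].
  - by exists (Some A).
  - by exists A => //; apply: val_inj.
  - by have := valP v; rewrite /= vE eqxx.
by exists (ContractionTree bin leaf_inj leafE), val, val, e0; split.
Qed.

(** * Equality of max rank and width *)

Section MaxRank.
Variables (T : contraction_tree N).
Variables (T' : carving_decomposition (structure_graph N)).
Variables (f : T -> T') (g : edge T -> edge T') (e0 : edge T').
Hypothesis hangs : hangs_free_vertex f g e0.

(** Root the carving decomposition at the free vertex. The side of [f n] holds the leaves below [n],
    and the free vertex lies on the other side. *)
Lemma cut_parent_arc e p n :
  parent_arc (cd_leaf T' None) e p (f n) ->
  #|cut (carve (T := T') e (f n))| = #|` free_indices (tensors_below n)|.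
Proof.
have [P leafE] := hangs; have [treeT' _] := cd_binary T'.
move=> arc; rewrite -card_cut_tensors; congr #|pred_of_set (cut _)|.
have bel v : connect (adj_in [set~ e]) (f n) v <-> below (cd_leaf T' None) (f n) v.
  by symmetry; apply: below_parent_arc arc.
apply/setP => -[A|]; rewrite !inE.
  rewrite (mem_imset _ _ Some_inj) inE leafE.
  apply/idP/asboolP => [/bel|] h; first exact/(pendant_below P).
  by apply/bel/(pendant_below P).
transitivity false; last by symmetry; apply/negbTE/imsetP => -[].
apply/negbTE; rewrite -(connect_parent_arc treeT' _ arc) connect_adj_in_sym.
by case: arc.
Qed.

(** Every node has a parent arc and every arc is the parent arc of a node, so both maxima range over
    the same numbers. *)
Lemma max_rank_width : max_rank T = width T'.
Proof.
have [P leafE] := hangs; have [treeT' _] := cd_binary T'.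
apply/eqP; rewrite eqn_leq; apply/andP; split.
  apply/bigmax_leqP => n _.
  have [e [p arc]] := parent_arc_of_vertex treeT' (vertex_neq P n).
  rewrite -(cut_parent_arc arc); apply: leq_trans (leq_bigmax e).
  apply: leq_bigmax_cond; case: arc => -> _ _; exact: set22.
apply/bigmax_leqP => e _; apply/bigmax_leqP => x xe.
have [p [n arc]] := parent_arc_of_edge treeT' (cd_leaf T' None) e.
have [n' nE] := vertex_onto P (parent_arc_neq_root treeT' arc); subst n.
apply: leq_trans (leq_bigmax n'); rewrite -(cut_parent_arc arc).
case: (arc) xe => -> _ _ /set2P[] -> //.
(* The parent side of the arc is the complement of the far side and has the same cut. *)
rewrite -cutC (_ : ~: _ = carve e (f n')) //; apply/setP => v; rewrite !inE.
by rewrite (connect_parent_arc treeT' _ arc) negbK.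
Qed.

End MaxRank.
End Ranks.

(** * Memory *)

(** The third address is returned without a test, as in the programs below: it is the only one left
    once some entry of the row is known to satisfy [P]. *)
Definition slot (P : pred nat) (m : nat -> nat) (k : nat) : nat :=
  if P (m (3 * k)) then 3 * k
  else if P (m (3 * k).+1) then (3 * k).+1 else (3 * k).+2.

(* Store 1 in an empty slot of the row of the root and the root in row 1. *)
Definition attach_program : program :=
  [:: ILoad 1 0; IAdd 2 1 1; IAdd 2 2 1; IConst 3 1;
      ILoad 4 2; IJumpz 4 10;
      IAdd 2 2 3; ILoad 4 2; IJumpz 4 10;
      IAdd 2 2 3;
      IStore 2 3;
      IConst 2 3; IStore 2 1; IConst 2 4; IStore 2 0; IConst 2 5; IStore 2 0].

(* The sum of the entries of row 1 is its only nonzero entry, the root of the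
   contraction tree. The jumps test [(1 - x) + (x - 1) = 0], that is [x = 1]. *)
Definition detach_program : program :=
  [:: IConst 1 3; IConst 2 1;
      ILoad 3 1; IAdd 1 1 2; ILoad 4 1; IAdd 3 3 4; IAdd 1 1 2; ILoad 4 1;
      IAdd 3 3 4;
      IAdd 5 3 3; IAdd 5 5 3;
      ILoad 4 5; ISub 6 4 2; ISub 4 2 4; IAdd 4 4 6; IJumpz 4 23;
      IAdd 5 5 2; ILoad 4 5; ISub 6 4 2; ISub 4 2 4; IAdd 4 4 6; IJumpz 4 23;
      IAdd 5 5 2;
      IStore 5 0; IStore 0 3].

(** * Symbolic execution of the two programs *)

Section Execution.

Lemma computes_run p m t m' k :
  k <= t ->
  (exists c g, iter k (step p) (initial m) = State c g m' /\ size p <= c) ->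
  computes p m t m'.
Proof. by move=> kt [c [g [e h]]]; exists k => //; rewrite /halted e. Qed.

Lemma update_same f a v : update f a v a = v.
Proof. by rewrite /update eqxx. Qed.

Lemma update_neq f a v b : b != a -> update f a v b = f b.
Proof. by rewrite /update => /negbTE ->. Qed.

Lemma iter_step n p s :
  iter n.+1 (step p) s =
  iter n (step p) (if onth p (counter s) is Some i then exec i s else s).
Proof. exact: iterSr. Qed.

Local Arguments iter : simpl never.
Local Arguments update : simpl never.
Local Opaque update.

Ltac run_step :=
  rewrite iter_step /=;
  repeat (rewrite update_same || rewrite update_neq //).

(** The cases are the three positions of the slot, with runs of 13, 16 and 17 steps. Register 0 is
    never written and supplies the constant 0. *)
Lemma attach_computes m :
  computes attach_program m 17
    (update (update (update (update m (slot (pred1 0) m (m 0)) 1)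
       3 (m 0)) 4 0) 5 0).
Proof.
(* The machine cannot multiply, so it forms the row address by two additions. *)
have k3 : 3 * m 0 = m 0 + m 0 + m 0 by lia.
rewrite /slot k3 /=.
have [e0|/negbTE e0] := eqVneq (m (m 0 + m 0 + m 0)) 0.
  apply: (@computes_run _ _ _ _ 13); [by []|]; rewrite /initial.
  do 5 run_step.
  run_step; rewrite e0 /=.
  do 7 run_step.
  by do 2 eexists; split; [reflexivity|].
have [e1|/negbTE e1] := eqVneq (m (m 0 + m 0 + m 0).+1) 0.
  apply: (@computes_run _ _ _ _ 16); [by []|]; rewrite /initial.
  do 5 run_step.
  run_step; rewrite e0 /=.
  do 2 run_step.
  run_step; rewrite !addn1 e1 /=.
  do 7 run_step.
  by do 2 eexists; split; [reflexivity|].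
apply: (@computes_run _ _ _ _ 17); [by []|]; rewrite /initial.
do 5 run_step.
run_step; rewrite e0 /=.
do 2 run_step.
run_step; rewrite !addn1 e1 /=.
do 8 run_step; rewrite !addn1.
by do 2 eexists; split; [reflexivity|].
Qed.

(** Again one case for each position of the slot, with runs of 18, 24 and 25 steps. Register 0 holds
    0, which is both the value that clears the slot and the address of the root. *)
Lemma detach_computes m k : m 3 + m 4 + m 5 = k ->
  computes detach_program m 25
    (update (update m (slot (pred1 1) m k) 0) 0 k).
Proof.
move=> kE; have k3 : 3 * k = k + k + k by lia.
have eq1 x : (1 - x + (x - 1) == 0) = (x == 1) by case: x => [|[|x]].
rewrite /slot k3 /=.
have [e0|/negbTE e0] := eqVneq (m (k + k + k)) 1.
  apply: (@computes_run _ _ _ _ 18); [by []|]; rewrite /initial.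
  do 9 run_step; rewrite kE; do 6 run_step.
  run_step; rewrite eq1 e0 /=.
  do 2 run_step.
  by do 2 eexists; split; [reflexivity|].
have [e1|/negbTE e1] := eqVneq (m (k + k + k).+1) 1.
  apply: (@computes_run _ _ _ _ 24); [by []|]; rewrite /initial.
  do 9 run_step; rewrite kE; do 6 run_step.
  run_step; rewrite eq1 e0 /=.
  do 5 run_step; rewrite !addn1.
  run_step; rewrite eq1 e1 /=.
  do 2 run_step.
  by do 2 eexists; split; [reflexivity|].
apply: (@computes_run _ _ _ _ 25); [by []|]; rewrite /initial.
do 9 run_step; rewrite kE; do 6 run_step.
run_step; rewrite eq1 e0 /=.
do 5 run_step; rewrite !addn1.
run_step; rewrite eq1 e1 /=.
do 3 run_step; rewrite !addn1.
by do 2 eexists; split; [reflexivity|].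
Qed.

End Execution.

(** * Effect of memory updates on rows *)

Lemma row_ext (m m' : nat -> nat) k :
  (forall a, a %/ 3 = k -> m' a = m a) -> Defs.row m' k = Defs.row m k.
Proof. by move=> mm'; rewrite /Defs.row !mm' //; lia. Qed.

Lemma slot_row P m k : slot P m k %/ 3 = k.
Proof. by rewrite /slot; case: ifP => _; [|case: ifP => _]; lia. Qed.

Lemma row_update_other m a v k :
  a %/ 3 != k -> Defs.row (update m a v) k = Defs.row m k.
Proof.
move=> ak; apply: row_ext => b bk; rewrite update_neq //.
by apply: contraNneq ak => <-; rewrite bk.
Qed.

(** A row with fewer than three nonzero entries has an empty cell, so the slot found is empty and no
    neighbour is overwritten. *)
Lemma row_fill m k v : v != 0 -> size (Defs.row m k) < 3 ->
  perm_eq (Defs.row (update m (slot (pred1 0) m k) v) k)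
          (rcons (Defs.row m k) v).
Proof.
move=> v0; rewrite /Defs.row /slot /update.
set x := 3 * k.
have E : ((x.+1 == x) = false) * ((x.+2 == x) = false) * ((x == x.+1) = false)
    * ((x == x.+2) = false) * ((x.+1 == x.+2) = false)
    * ((x.+2 == x.+1) = false) by do !split; lia.
case Ea: (m x) => [|a]; case Eb: (m x.+1) => [|b]; case Ec: (m x.+2) => [|c];
  rewrite [pred1 _ _]/= !(E, eqxx, Ea, Eb, Ec, v0) //= ?v0 => _;
  apply/permP => q /=; lia.
Qed.

(** As [v] occurs in the row, the slot found holds [v], and clearing it removes exactly one
    occurrence. *)
Lemma row_clear m k v : v != 0 -> v \in Defs.row m k ->
  perm_eq (Defs.row m k)
          (rcons (Defs.row (update m (slot (pred1 v) m k) 0) k) v).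
Proof.
move=> v0; rewrite /Defs.row /slot /update.
set x := 3 * k.
have E : ((x.+1 == x) = false) * ((x.+2 == x) = false) * ((x == x.+1) = false)
    * ((x == x.+2) = false) * ((x.+1 == x.+2) = false)
    * ((x.+2 == x.+1) = false) by do !split; lia.
rewrite mem_filter v0 /= !inE ![v == _]eq_sym.
have [Ea|/negbTE Ea] := eqVneq (m x) v.
  rewrite !(E, eqxx, Ea, v0) /= => _.
  by case: (_ != 0); case: (_ != 0); apply/permP => q /=; lia.
have [Eb|/negbTE Eb] := eqVneq (m x.+1) v.
  rewrite !(E, eqxx, Eb, v0) /= => _.
  by case: (_ != 0); case: (_ != 0); apply/permP => q /=; lia.
move=> /eqP Ec; rewrite !(E, eqxx, Ec, v0) /=.
by case: (_ != 0); case: (_ != 0); apply/permP => q /=; lia.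
Qed.

(** Sending a neighbour to an edge shared with [x] is injective, since an edge has only one end
    other than [x]. *)
Lemma card_adj_le_degree (G : graph) (x : G) : #|adj x| <= degree x.
Proof.
pose common y := [pick e | (e \in delta x) && (e \in delta y)].
have commonP y : adj x y ->
    exists2 e, common y = Some e & (e \in delta x) && (e \in delta y).
  case/adj_inP => _ [e [_ ex ey]]; rewrite /common; case: pickP => [d|/(_ e)].
    by exists d.
  by rewrite ex ey.
rewrite -(@card_in_imset _ _ common).
  rewrite /degree -[leqRHS](card_imset _ Some_inj); apply: subset_leq_card.
  apply/subsetP => _ /imsetP[y xy ->]; have [e -> /andP[ex _]] := commonP y xy.
  exact: imset_f.
move=> y y' xy xy'; have [e -> /andP[ex ey]] := commonP y xy.
have [e' -> /andP[_ ey'] [ee']] := commonP y' xy'; subst e'.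
have /adj_inP[nxy _] : adj x y := xy; have /adj_inP[nxy' _] : adj x y' := xy'.
have : y' \in [set x; y] by rewrite -(ends_pair nxy ex ey) inE.
by rewrite !inE eq_sym (negPf nxy') => /eqP.
Qed.

(** * Stored trees before and after conversion *)

Section Storage.
Variables (R : realType) (I : choiceType) (dom : I -> finType).
Variables (N : tensor_network R dom) (nu : N -> 'I_#|` N|).
Variables (T : contraction_tree N).
Variables (T' : carving_decomposition (structure_graph N)).
Variables (f : T -> T') (g : edge T -> edge T') (e0 : edge T').
Hypothesis hangs : hangs_free_vertex f g e0.

Let z := cd_leaf T' None.
Let P : pendant (ct_root T) z f g e0 := hangs.1.

Lemma leaves_hang v : (f v \in leaves T') = (v \in leaves T).
Proof.
rewrite (pendant_leaves P (ct_binary T)) !inE (negPf (vertex_neq P v)) /=.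
by rewrite (mem_imset _ _ (vertex_inj P)) inE.
Qed.

(** The degree of the root in [T'] is at most three and one of its neighbours there is [z]; hence
    its row has room for [z]. *)
Lemma size_enum_adj_root : size (enum (adj (ct_root T))) < 3.
Proof.
have := perm_size (pendant_enum_adj P (ct_root T)).
rewrite eqxx size_cat size_map addn1 => <-.
rewrite -cardE; apply: leq_trans (card_adj_le_degree _) _.
by have [_ /(_ (f (ct_root T)))[]->] := cd_binary T'.
Qed.

Lemma hang_stored m :
  stores_contraction_tree nu T m ->
  stores_carving_decomposition nu T'
    (update (update (update (update m (slot (pred1 0) m (m 0)) 1)
       3 (m 0)) 4 0) 5 0).
Proof.
case=> num [[num_inj num_leaf num_in] store root].
(* The number 1 is thus free for [z], and writing to row 1 disturbs no node of [T]. *)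
have num_gt1 v : 1 < num v.
  have [|vN] := boolP (v \in leaves T).
    by rewrite -ct_leaves => /imsetP[A _ ->]; rewrite num_leaf.
  by have := num_in v vN; lia.
have [h [fK hz]] := pendant_retraction P.
pose num' x := if x == z then 1 else num (h x).
have num'f v : num' (f v) = num v by rewrite /num' (negPf (vertex_neq P v)) fK.
have num'z : num' z = 1 by rewrite /num' eqxx.
exists num'; split.
  split.
  - move=> x y; have [->|/(vertex_onto P)[u ->]] := eqVneq x z;
      have [->|/(vertex_onto P)[v ->]] := eqVneq y z; rewrite ?num'z ?num'f //.
    + by have := num_gt1 v; lia.
    + by have := num_gt1 u; lia.
    + by move/num_inj ->.
  - by case=> [A|]; rewrite /= ?num'z // hangs.2 num'f num_leaf.
  - move=> x; have [->|/(vertex_onto P)[u ->]] := eqVneq x z.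
      by rewrite -cd_leaves imset_f.
    by rewrite leaves_hang num'f; apply: num_in.
move=> x; have [->|/(vertex_onto P)[u ->]] := eqVneq x z.
  (* Row 1 may hold anything before the run, so all three of its cells are overwritten. *)
  rewrite num'z (enum_adj_pendant P) /= num'f root.
  rewrite /Defs.row /update /=; have := num_gt1 (ct_root T).
  by case: (num _).
have u1 := num_gt1 u; rewrite num'f.
rewrite !(@row_update_other _ 5) ?(@row_update_other _ 4)
  ?(@row_update_other _ 3); try by rewrite /= neq_ltn u1.
rewrite perm_sym; apply: perm_trans (perm_map num' (pendant_enum_adj P u)) _.
rewrite map_cat -map_comp (eq_map num'f) perm_sym.
(* The filled slot lies in the row of the root, so every other node keeps its row. *)
have [->|ur] := eqVneq u (ct_root T); last first.
  rewrite cats0 row_update_other // slot_row root.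
  by rewrite (inj_eq num_inj) eq_sym.
rewrite /= num'z cats1 root; apply: perm_trans (row_fill _ _) _ => //.
  by rewrite (perm_size (store _)) size_map size_enum_adj_root.
by rewrite -!cats1 perm_cat2r.
Qed.

Lemma unhang_stored m :
  stores_carving_decomposition nu T' m ->
  let k := m 3 + m 4 + m 5 in
  stores_contraction_tree nu T
    (update (update m (slot (pred1 1) m k) 0) 0 k).
Proof.
case=> num [[num_inj num_leaf num_in] store] k.
(* No vertex has row 0, so writing the root at address 0 is harmless. *)
have num_gt0 x : 0 < num x.
  have [|xN] := boolP (x \in leaves T').
    by rewrite -cd_leaves => /imsetP[[A|] _ ->]; rewrite num_leaf.
  by have := num_in x xN; lia.
have numz : num z = 1 by rewrite num_leaf.
(* The only neighbour of [z] is the root, so row 1 has a single nonzero entry and the sum finds it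
   in any cell. *)
have kE : k = num (f (ct_root T)).
  have := store z; rewrite numz (enum_adj_pendant P) => /perm_small_eq -/(_ isT).
  rewrite /Defs.row /= /k.
  by case: (m 3) (m 4) (m 5) => [|a] [|b] [|c] //= [<-]; lia.
exists (num \o f); split; last by rewrite update_same.
  split.
  - exact: inj_comp num_inj (vertex_inj P).
  - by move=> A; rewrite /= -hangs.2 num_leaf.
  - by move=> v vN; apply: num_in; rewrite leaves_hang.
move=> v; rewrite /= row_update_other; last by rewrite neq_ltn num_gt0.
have := pendant_enum_adj P v => /(perm_map num)/(perm_trans (store (f v))).
rewrite map_cat -map_comp.
have [->|vr] := eqVneq v (ct_root T); last first.
  by rewrite cats0 row_update_other // slot_row kE (inj_eq num_inj)
    (inj_eq (vertex_inj P)) eq_sym.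
rewrite /= numz -kE cats1 => root.
(* The root is adjacent to [z], which has number 1, so there is an entry to clear. *)
have : 1 \in Defs.row m k by rewrite (perm_mem root) mem_rcons mem_head.
move/row_clear => /(_ isT); rewrite perm_sym => /perm_trans/(_ root).
by rewrite -!cats1 perm_cat2r.
Qed.

End Storage.

(** A constant bound is also a linear one, because a tensor network is nonempty. *)
Lemma computes_linear (K : choiceType) (S : {fset K}) p m t m' :
  S != fset0 -> computes p m t m' -> computes p m (t * #|` S|) m'.
Proof.
rewrite -cardfs_gt0 => S0 [k kt km]; exists k => //.
exact: leq_trans kt (leq_pmulr _ S0).
Qed.

(** * Equivalence of the two decompositions and their linear-time conversion *)

Theorem theorem2 :
  (forall (R : realType) (I : choiceType) (dom : I -> finType)
          (N : tensor_network R dom) (w : nat),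
     (exists T : contraction_tree N, max_rank T = w) <->
     (exists T : carving_decomposition (structure_graph N), width T = w))
  /\
  (exists (p : program) (c : nat),
   forall (R : realType) (I : choiceType) (dom : I -> finType)
          (N : tensor_network R dom) (w : nat)
          (nu : N -> 'I_(#|` N|)) (T : contraction_tree N) (m : nat -> nat),
     injective nu -> max_rank T = w -> stores_contraction_tree nu T m ->
     exists (m' : nat -> nat)
            (T' : carving_decomposition (structure_graph N)),
       [/\ computes p m (c * #|` N|) m', width T' = w &
           stores_carving_decomposition nu T' m'])
  /\
  (exists (p : program) (c : nat),
   forall (R : realType) (I : choiceType) (dom : I -> finType)
          (N : tensor_network R dom) (w : nat)
          (nu : N -> 'I_(#|` N|))
          (T : carving_decomposition (structure_graph N)) (m : nat -> nat),
     injective nu -> width T = w -> stores_carving_decomposition nu T m ->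
     exists (m' : nat -> nat) (T' : contraction_tree N),
       [/\ computes p m (c * #|` N|) m', max_rank T' = w &
           stores_contraction_tree nu T' m']).
Proof.
split; [|split].
- move=> R I dom N w; split=> -[T <-].
    have [T' [f [g [e0 hangs]]]] := hang_free_vertex T.
    by exists T'; rewrite (max_rank_width hangs).
  have [T' [f [g [e0 hangs]]]] := unhang_free_vertex T.
  by exists T'; rewrite (max_rank_width hangs).
(* All jumps go forward, so the length of the program bounds its running time; the constant 25 for
   the converse arises in the same way. *)
- exists attach_program, 17 => R I dom N w nu T m _ <- store.
  have [T' [f [g [e0 hangs]]]] := hang_free_vertex T.
  eexists; exists T'; split; last exact: hang_stored hangs _ store.
    exact/(computes_linear (tn_nonempty N))/attach_computes.
  by rewrite (max_rank_width hangs).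
exists detach_program, 25 => R I dom N w nu T m _ <- store.
have [T' [f [g [e0 hangs]]]] := unhang_free_vertex T.
eexists; exists T'; split; last exact: unhang_stored hangs _ store.
  exact/(computes_linear (tn_nonempty N))/detach_computes/erefl.
by rewrite (max_rank_width hangs).
Qed.
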